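(* Let $\lambda,\lambda_1,\lambda_2,\alpha,\beta>0$. Let $N_1,N_2$ be Poisson processes with intensities $\lambda_1,\lambda_2$, let $G_N$ be a compound Poisson-Gamma process with parameters $\lambda,\alpha,\beta$, and let $N_1,N_2,G_N$ be mutually independent. Put $S_I(t)=N_1(G_N(t))-N_2(G_N(t))$. Then the probabilities $r_k(t)=P(S_I(t)=k)$, $k\in\mathbb{Z}$, are given by $$r_k(t)=e^{-\lambda t}\left(\frac{\lambda_1}{\lambda_2}\right)^{k/2}\int_0^{\infty}e^{-u(\lambda_1+\lambda_2+\beta)}\,I_{|k|}\bigl(2u\sqrt{\lambda_1\lambda_2}\bigr)\,\frac1u\,\Phi\bigl(\alpha,0,\lambda t(\beta u)^{\alpha}\bigr)\,du .$$ The moment generating function of $S_I(t)$ has the form $$\mathsf{E}e^{\theta S_I(t)}=\exp\left\{-\lambda t\left(1-\beta^{\alpha}\bigl(\beta+\lambda_1+\lambda_2-\lambda_1e^{\theta}-\lambda_2e^{-\theta}\bigr)^{-\alpha}\right)\right\}$$ for $\theta$ such that $\beta+\lambda_1+\lambda_2-\lambda_1e^{\theta}-\lambda_2e^{-\theta}\neq 0$.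
   Context: The compound Poisson-Gamma process with parameters $\lambda,\alpha,\beta$ is $G_N(t)=\sum_{n=1}^{N(t)}G_n$, where $N$ is a Poisson process with intensity $\lambda$ and $G_n$ are i.i.d. Gamma random variables with shape $\alpha$ and rate $\beta$, independent of $N$ (empty sum $=0$). $I_k$ is the modified Bessel function of the first kind, $I_k(z)=\sum_{n=0}^{\infty}\frac{(z/2)^{2n+k}}{n!(n+k)!}$ for integers $k\ge 0$. $\Phi(\rho,0,z)=\sum_{j=1}^{\infty}\frac{z^{j}}{j!\,\Gamma(\rho j)}$ is the Wright function with second parameter $0$.
   Formalization: The formula for r_k(t) gets the extra term e^{-λt} when k=0 (the atom of G_N(t) at 0, missing as printed), and the moment generating function is stated for β+λ1+λ2−λ1e^θ−λ2e^{−θ}>0 instead of ≠0, since it is infinite for negative values when t>0. *)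

(* Defs.v *)
From HB Require Import structures.
From mathcomp Require Export all_boot all_order all_algebra.
From mathcomp Require Export all_classical all_reals all_analysis.
Export Order.TTheory GRing.Theory Num.Theory.
Export numFieldNormedType.Exports.

Set Implicit Arguments.
Unset Strict Implicit.
Unset Printing Implicit Defensive.

Local Open Scope classical_set_scope.
Local Open Scope ring_scope.

Section special_functions.
Context {R : realType}.

Definition gamma_fun (a : R) : R :=
  \int[lebesgue_measure]_(x in `]0, +oo[) (x `^ (a - 1) * expR (- x)).

Definition gamma_pdf (shape rate x : R) : R :=
  if 0 < x then
    rate `^ shape / gamma_fun shape * x `^ (shape - 1) * expR (- (rate * x))
  else 0.

Definition besselI (k : nat) (z : R) : R :=
  limn (series (fun n : nat =>
    (z / 2) ^+ (2 * n + k) / (n`!%:R * (n + k)`!%:R))).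

(* The Wright function Phi(rho, 0, z): its j = 0 term vanishes (1/Gamma(0) = 0),
   so the j-th term of the series below is the one of index j.+1. *)
Definition wright0 (rho z : R) : R :=
  limn (series (fun j : nat =>
    z ^+ j.+1 / (j.+1`!%:R * gamma_fun (rho * j.+1%:R)))).

End special_functions.

Section processes.
Context d (T : measurableType d) (R : realType) (P : probability T R).

Definition sigma_process (I : Type) d' (U : measurableType d')
    (X : I -> T -> U) : set (set T) :=
  <<s \bigcup_i preimage_set_system setT (X i) measurable >>.

(* Mutual independence: the product rule over every finite subfamily. *)
Definition independent (I : eqType) (F : I -> set (set T)) : Prop :=
  forall (s : seq I) (A : I -> set T), uniq s ->
    (forall i, i \in s -> F i (A i)) ->
    P (\big[setI/setT]_(i <- s) A i) = (\prod_(i <- s) P (A i))%E.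

(* Processes on [0, +oo[ are indexed by the whole of R and, by convention,
   vanish at nonpositive times. Right-continuity of all the paths makes the
   evaluation of the process at a random time measurable. The difference of
   natural numbers is truncated, harmlessly since paths are nondecreasing. *)
Definition poisson_process (lam : R) (N : R -> {RV P >-> nat}) : Prop :=
  [/\ forall w t, t <= 0 -> N t w = 0%N,
      forall w s t, s <= t -> (N s w <= N t w)%N,
      forall w t, N s w @[s --> t^'+] --> N t w,
      forall t : nat -> R, 0 <= t 0%N -> nondecreasing_seq t ->
        independent (fun i : nat => preimage_set_system setT
          (fun w => N (t i.+1) w - N (t i) w)%N measurable)
    & forall s t k, 0 <= s -> s < t ->
        P [set w | (N t w - N s w)%N = k] =
        (poisson_pmf (lam * (t - s)) k)%:E].

Definition gamma_distributed (shape rate : R) (Y : {RV P >-> R}) : Prop :=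
  forall A : set R, measurable A ->
    P (Y @^-1` A) =
    (\int[lebesgue_measure]_(x in A) (gamma_pdf shape rate x)%:E)%E.

Definition compound_poisson_gamma (lam a b : R) (X : R -> {RV P >-> R}) :=
  exists (N : R -> {RV P >-> nat}) (G : nat -> {RV P >-> R}),
    [/\ poisson_process lam N,
        forall n, gamma_distributed a b (G n),
        independent (fun n : nat => preimage_set_system setT (G n) measurable),
        independent (tnth [tuple sigma_process N; sigma_process G])
      & forall t w, X t w = \sum_(0 <= n < N t w) G n w].

Definition subordinated_difference (N1 N2 : R -> {RV P >-> nat})
    (X : R -> {RV P >-> R}) (t : R) (w : T) : int :=
  (N1 (X t w) w)%:Z - (N2 (X t w) w)%:Z.

End processes.

(* Main.v *)
(* Conditionally on the subordinator, N1 and N2 are independent Poisson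
   variables.  To make this rigorous for a random time X, replace X by the grid
   point following it: there the law is a countable sum of products, and
   right-continuity of the paths together with dominated convergence gives
   P(N1(X) = m, N2(X) = k) = E[pois(lam1 X, m) pois(lam2 X, k)].
   The law of X is a Poisson mixture of gamma laws of shapes n a (with an atom
   at 0 for n = 0), because gamma densities are stable under convolution; the
   constant produced by the convolution is a beta integral, which need not be
   evaluated since the total mass must be 1.  Summing over m - k fixed yields
   the Bessel function, summing the mixture yields the Wright function, and
   the moment generating function follows from Tonelli. *)
Require Import Defs.
From HB Require Import structures.
From mathcomp Require Import measurable_realfun zify ring lra.

Set Implicit Arguments.
Unset Strict Implicit.
Unset Printing Implicit Defensive.

Local Open Scope classical_set_scope.
Local Open Scope ring_scope.

(** * Affine changes of variable and densities *)

Definition image_measure d d' (T : measurableType d) (T' : measurableType d')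
    (R : realType) (mu : {measure set T -> \bar R}) (f : T -> T')
    (mf : measurable_fun setT f) : {measure set T' -> \bar R} :=
  measure_function_pushforward__canonical__measure_function_Measure mu mf.

Section affine_change_of_variable.
Context {R : realType}.
Local Open Scope ereal_scope.
Local Notation mu := (@lebesgue_measure R).

(* [lebesgue_measure] lives on the copy [measurableTypeR R] of [R]: its
   measurable sets are convertible to those of [R], but the displays of the two
   structures do not unify. *)
Let measurable_affine (r s : R) :
  @measurable_fun _ _ (measurableTypeR R) (measurableTypeR R) setT
    (fun x : R => (r * x + s)%R).
Proof.
suff: measurable_fun [set: R] (fun x : R => (r * x + s)%R) by [].
exact/measurable_funD/measurable_cst/measurable_funM.
Qed.

Let affine_scaled (r s : R) (r0 : (0 <= r)%R) :
    {measure set (measurableTypeR R) -> \bar R} :=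
  mscale (NngNum r0) (image_measure mu (measurable_affine r s)).

(** Lebesgue measure is determined by half-open intervals; there, [r] times the image measure under
    x -> r x + s gives the length back. *)
Lemma lebesgue_measure_affine (r s : R) (A : set R) : (0 < r)%R ->
  measurable A ->
  mu A = r%:E * mu ((fun x => r * x + s)%R @^-1` A).
Proof.
move=> r0 mA.
rewrite (@lebesgue_measure_unique R (affine_scaled s (ltW r0)))//= => _ [[a b]] _ <-.
rewrite /affine_scaled/= /mscale /= /pushforward/=.
rewrite (_ : _ @^-1` _ = `](a - s) / r, (b - s) / r]%classic)%R; last first.
  apply/seteqP; split => x /=; rewrite !in_itv/= ltr_pdivrMr// ler_pdivlMr//;
    by rewrite ltrBlDr lerBrDr mulrC.
rewrite !lebesgue_measure_itv/= !lte_fin ltr_pM2r ?invr_gt0// ltrD2r.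
case: ifPn => _; last by rewrite mule0.
rewrite -!EFinB -EFinM; congr EFin; field.
exact: lt0r_neq0.
Qed.

Lemma ge0_integral_affine (r s : R) (f : R -> \bar R) : (0 < r)%R ->
  measurable_fun [set: R] f -> (forall x, 0 <= f x) ->
  \int[mu]_x f x = r%:E * \int[mu]_x f (r * x + s)%R.
Proof.
move=> r0 mf f0.
rewrite (eq_measure_integral (affine_scaled s (ltW r0))); last first.
  by move=> A mA _; exact: lebesgue_measure_affine.
by rewrite ge0_integral_mscale// ge0_integral_pushforward.
Qed.

End affine_change_of_variable.

(** * Integration against a measure given by a density *)

Section density.
Local Open Scope ereal_scope.
Context d (T : measurableType d) (R : realType).
Variables (mu nu : {measure set T -> \bar R}) (f : T -> R).
Hypotheses (mf : measurable_fun [set: T] f) (f0 : forall x, (0 <= f x)%R).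
Hypothesis nuE : forall A, measurable A -> nu A = \int[mu]_(x in A) (f x)%:E.

Import HBNNSimple.

(** Monotone convergence along simple approximations of [h], on both sides, reduces the formula to
    indicators, where it is [nuE]. *)
Lemma ge0_integral_density (h : T -> \bar R) :
  measurable_fun [set: T] h -> (forall x, 0 <= h x) ->
  \int[nu]_x h x = \int[mu]_x (h x * (f x)%:E).
Proof.
move=> mh h0.
pose h_ := nnsfun_approx measurableT mh.
have hE x : h x = limn (fun n => (h_ n x)%:E).
  by apply/esym/cvg_lim => //; exact: cvg_nnsfun_approx.
have ndh x : {homo (fun n => (h_ n x)%:E) : n m / (n <= m)%N >-> n <= m}.
  by move=> n m nm; rewrite lee_fin; exact/lefP/nd_nnsfun_approx.
transitivity (limn (fun n => \int[nu]_x (h_ n x)%:E)).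
  rewrite -monotone_convergence//.
  - by apply: eq_integral => x _; rewrite hE.
  - by move=> n; exact/measurable_EFinP.
  - by move=> n x _; rewrite lee_fin.
transitivity (limn (fun n => \int[mu]_x ((h_ n x)%:E * (f x)%:E))); last first.
  rewrite -monotone_convergence//.
  - apply: eq_integral => x _; rewrite hE; apply/cvg_lim => //.
    apply: cvgeZr => //.
    by apply: ereal_nondecreasing_is_cvgn; exact: ndh.
  - by move=> n; apply: emeasurable_funM; exact/measurable_EFinP.
  - by move=> n x _; rewrite mule_ge0// lee_fin.
  - by move=> x _ n m nm; apply: lee_wpmul2r; [rewrite lee_fin|exact: ndh].
congr (limn _); apply/funext => n.
have mind (k : R) : measurable (h_ n @^-1` [set k]) by exact: measurable_sfunP.
under [LHS]eq_integral do rewrite fimfunE -fsumEFin//.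
under [RHS]eq_integral do rewrite fimfunE -fsumEFin//.
rewrite ge0_integral_fsum//; last 2 first.
  by move=> k; exact/measurable_EFinP/measurable_funM.
  by move=> k x _; exact: nnfun_muleindic_ge0.
transitivity (\int[mu]_x \sum_(k \in range (h_ n))
    ((k * \1_(h_ n @^-1` [set k]) x)%:E * (f x)%:E)).
  rewrite ge0_integral_fsum//; last 2 first.
  - by move=> k; apply: emeasurable_funM; apply/measurable_EFinP;
      [exact: measurable_funM|].
  - by move=> k x _; apply: mule_ge0; [exact: nnfun_muleindic_ge0|rewrite lee_fin].
  apply: eq_fsbigr => k _.
  (* A negative [k] has an empty fiber, so both terms vanish; a nonnegative one can be pulled out of
     the integrals. *)
  have [k0|k0] := leP 0%R k; last first.
    rewrite preimage_nnfun0//.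
    rewrite !integral0_eq// => x _; by rewrite indic0 mulr0 ?mul0e.
  under eq_integral do rewrite EFinM.
  rewrite ge0_integralZl//; last exact/measurable_EFinP.
  rewrite integral_indic// setIT nuE//.
  under [RHS]eq_integral do rewrite EFinM -muleA.
  rewrite ge0_integralZl//; last 2 first.
  - by apply: emeasurable_funM; exact/measurable_EFinP.
  - by move=> x _; apply: mule_ge0; rewrite lee_fin.
  congr (_ * _); rewrite integral_mkcond; apply: eq_integral => x _.
  rewrite patchE indicE; case: (x \in _); by rewrite ?mul1e ?mul0e.
apply: eq_integral => x _.
by rewrite ge0_mule_fsuml// => k; exact: nnfun_muleindic_ge0.
Qed.

End density.

(** * Convolution of gamma kernels *)

Section gamma_kernel.
Context {R : realType}.
Implicit Types p q c x z : R.
Local Notation mu := (@lebesgue_measure R).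

(** Unnormalised gamma density of shape [p] and rate [c]. Rate 0 gives the pure power that enters
    the beta integral. *)
Definition gamma_kernel p c x : R :=
  if 0 < x then x `^ (p - 1) * expR (- (c * x)) else 0.

Lemma gamma_kernel_ge0 p c x : 0 <= gamma_kernel p c x.
Proof.
by rewrite /gamma_kernel; case: ifPn => // _; rewrite mulr_ge0 ?powR_ge0 ?expR_ge0.
Qed.

Lemma measurable_gamma_kernel p c : measurable_fun [set: R] (gamma_kernel p c).
Proof.
apply: measurable_fun_ifT => //; first exact: measurable_fun_ltr.
apply: measurable_funM; first exact: measurable_powR.
by apply: measurableT_comp => //; apply: measurableT_comp => //; exact: measurable_funM.
Qed.

Let measurable_EFin_kernel p c :
  measurable_fun [set: R] (fun x => (gamma_kernel p c x)%:E).
Proof. by apply/measurable_EFinP; exact: measurable_gamma_kernel. Qed.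

Lemma gamma_kernelZ p c r x : 0 < r ->
  gamma_kernel p c (r * x) = r `^ (p - 1) * gamma_kernel p (c * r) x.
Proof.
move=> r0; rewrite /gamma_kernel pmulr_rgt0//; case: ifPn => x0; last by rewrite mulr0.
by rewrite powRM ?ltW// !mulrA.
Qed.

Lemma gamma_pdfE p b x :
  gamma_pdf p b x = b `^ p / gamma_fun p * gamma_kernel p b x.
Proof.
by rewrite /gamma_pdf /gamma_kernel; case: ifPn => _; rewrite ?mulr0// mulrA.
Qed.

Local Open Scope ereal_scope.

Lemma integral_gamma_kernel p c : (0 < c)%R ->
  \int[mu]_x (gamma_kernel p c x)%:E =
  (c `^ (- p))%:E * \int[mu]_x (gamma_kernel p 1 x)%:E.
Proof.
move=> c0.
rewrite (@ge0_integral_affine _ c^-1 0); first last.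
- by move=> x; rewrite lee_fin gamma_kernel_ge0.
- exact: measurable_EFin_kernel.
- by rewrite invr_gt0.
under eq_integral => x _.
  rewrite addr0 gamma_kernelZ ?invr_gt0// divff ?gt_eqF// EFinM.
  over.
rewrite ge0_integralZl_EFin ?powR_ge0//; first last.
- exact: measurable_EFin_kernel.
- by move=> x _; rewrite lee_fin gamma_kernel_ge0.
rewrite muleA -EFinM; congr (_%:E * _).
rewrite -powR_inv1 ?ltW// -powRrM -powRD; last by rewrite (gt_eqF c0) implybT.
congr (_ `^ _)%R; ring.
Qed.

Lemma gamma_fun_kernel p :
  gamma_fun p = fine (\int[mu]_x (gamma_kernel p 1 x)%:E).
Proof.
rewrite /gamma_fun /Rintegral integral_mkcond; congr fine.
apply: eq_integral => x _; rewrite patchE /gamma_kernel.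
by rewrite mem_setE in_itv/= andbT mul1r; case: ifPn.
Qed.

(** Euler's beta integral: the integrand lives on 0 < x < 1. Its value stays in the extended reals
    until a total mass fixes it. *)
Definition beta_integral p q : \bar R :=
  \int[mu]_x (gamma_kernel p 0 x * gamma_kernel q 0 (1 - x))%:E.

Let measurable_conv p q c z :
  measurable_fun [set: R]
    (fun x => (gamma_kernel p c x * gamma_kernel q c (z - x))%:E).
Proof.
apply/measurable_EFinP.
apply: measurable_funM; first exact: measurable_gamma_kernel.
apply: measurableT_comp; first exact: measurable_gamma_kernel.
exact: measurable_funB.
Qed.

(** For [z > 0], substituting z x for x makes the exponentials multiply to the constant e^(-c z) and
    leaves the beta integrand. For [z <= 0] the supports do not meet. *)
Lemma gamma_kernel_convolution p q c z :
  \int[mu]_x (gamma_kernel p c x * gamma_kernel q c (z - x))%:E =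
  (gamma_kernel (p + q) c z)%:E * beta_integral p q.
Proof.
have nneg c' z' x : 0 <= (gamma_kernel p c' x * gamma_kernel q c' (z' - x))%:E.
  by rewrite lee_fin mulr_ge0 ?gamma_kernel_ge0.
have [z0|z0] := ltP 0%R z; last first.
  rewrite [gamma_kernel (p + q) _ _]/gamma_kernel ltNge z0/= mul0e integral0_eq// => x _.
  rewrite /gamma_kernel; case: ifPn => x0; last by rewrite mul0r.
  case: ifPn => zx; last by rewrite mulr0.
  by move: zx; rewrite subr_gt0 => /(lt_trans x0); rewrite ltNge z0.
etransitivity; first exact: (@ge0_integral_affine _ z 0).
under eq_integral => x _.
  rewrite addr0 (_ : z - z * x = z * (1 - x))%R; last by ring.
  rewrite !gamma_kernelZ// (_ : _ * _ = z `^ (p - 1) * z `^ (q - 1) * expR (- (c * z)) *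
   (gamma_kernel p 0 x * gamma_kernel q 0 (1 - x)))%R; last first.
    rewrite /gamma_kernel; case: ifPn => x0; last by rewrite !(mul0r, mulr0).
    case: ifPn => x1; last by rewrite !(mul0r, mulr0).
    rewrite !mul0r oppr0 expR0 !mulr1.
    rewrite (_ : - (c * z) = - (c * z * x) + - (c * z * (1 - x)))%R; last by ring.
    rewrite expRD; ring.
  rewrite EFinM; over.
rewrite ge0_integralZl_EFin//; last 2 first.
- exact: measurable_conv.
- by rewrite !mulr_ge0 ?powR_ge0 ?expR_ge0.
rewrite muleA -EFinM; congr (_%:E * _).
rewrite /gamma_kernel z0 !mulrA; congr (_ * _)%R.
(* The Jacobian [z] counts as a power of exponent 1, so the exponents add up to p + q - 1. *)
rewrite -{1}(powRr1 (ltW z0)) -!powRD; try by rewrite (gt_eqF z0) implybT.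
congr (_ `^ _)%R; ring.
Qed.

Let lebesgue_integralZr (f : R -> \bar R) (k : \bar R) :
  measurable_fun [set: R] f -> (forall x, 0 <= f x) -> 0 <= k ->
  \int[mu]_x (f x * k) = (\int[mu]_x f x) * k.
Proof. by move=> mf f0 k0; exact: ge0_integralZr. Qed.

(** With z = x + y, Tonelli's theorem lets x be integrated first; the inner integral is then the
    convolution of the kernels at z. *)
Lemma integral_gamma_kernelD p q c (h : R -> \bar R) :
  measurable_fun [set: R] h -> (forall x, 0 <= h x) ->
  \int[mu]_x (\int[mu]_y (h (x + y)%R * (gamma_kernel q c y)%:E) *
    (gamma_kernel p c x)%:E) =
  beta_integral p q * \int[mu]_z (h z * (gamma_kernel (p + q) c z)%:E).
Proof.
move=> mh h0.
have mk r s : measurable_fun [set: R] (fun x => (gamma_kernel r s x)%:E).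
  by apply/measurable_EFinP; exact: measurable_gamma_kernel.
have k0 r s x : 0 <= (gamma_kernel r s x)%:E by rewrite lee_fin gamma_kernel_ge0.
have mhk : measurable_fun [set: R] (fun z => h z * (gamma_kernel (p + q) c z)%:E).
  exact: emeasurable_funM.
pose F (u : R * R) :=
  h u.2 * (gamma_kernel q c (u.2 - u.1))%:E * (gamma_kernel p c u.1)%:E.
have mF : measurable_fun [set: R * R] F.
  apply: emeasurable_funM; first apply: emeasurable_funM.
  - exact: measurableT_comp measurable_snd.
  - apply: (measurableT_comp (mk _ _)).
    by apply: measurable_funB; [exact: measurable_snd|exact: measurable_fst].
  - apply: (measurableT_comp (mk _ _)); exact: measurable_fst.
have F0 u : 0 <= F u by rewrite !mule_ge0.
transitivity (\int[mu]_x \int[mu]_z F (x, z)).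
  apply: eq_integral => x _.
  rewrite (@ge0_integral_affine _ 1 (- x)%R)//; last 2 first.
  - apply: emeasurable_funM => //; apply: (measurableT_comp mh).
    exact: measurable_funD.
  - by move=> y; rewrite mule_ge0.
  rewrite mul1e.
  etransitivity; first (apply/esym/lebesgue_integralZr => //).
  - have maff : measurable_fun [set: R] (fun z => 1 * z - x)%R.
      by apply: measurable_funB => //; exact: measurable_funM.
    apply: emeasurable_funM; last exact: (measurableT_comp (mk q c) maff).
    by apply: (measurableT_comp mh); exact: measurable_funD.
  - by move=> y; rewrite mule_ge0.
  apply: eq_integral => z _.
  by rewrite /F/= mul1r addrCA subrr addr0.
transitivity (\int[mu]_z \int[mu]_x F (x, z)).
  exact: (fubini_tonelli (m1 := mu) (m2 := mu)).
rewrite [RHS]muleC; etransitivity; last (apply/lebesgue_integralZr => //);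
  last 2 first.
- by move=> z; rewrite mule_ge0.
- by apply: integral_ge0 => x _; rewrite lee_fin mulr_ge0 ?gamma_kernel_ge0.
apply: eq_integral => z _.
rewrite -muleA -gamma_kernel_convolution muleC.
etransitivity; last apply/lebesgue_integralZr => //.
- by apply: eq_integral => x _; rewrite /F/= EFinM muleC -muleA [X in _ = _ * X]muleC.
- by move=> x; rewrite lee_fin mulr_ge0 ?gamma_kernel_ge0.
Qed.

End gamma_kernel.

(** * Independence *)

Section independence.
Context d (T : measurableType d) (R : realType) (P : probability T R).
Local Open Scope ereal_scope.

(** Built from a proof of measurability, so that it applies to functions carrying no random variable
    structure. *)
Definition law d' (U : measurableType d') (X : T -> U)
    (mX : measurable_fun setT X) : probability U R :=
  distribution P (HB.pack_for {mfun T >-> U} X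
    (isMeasurableFun.Build _ _ _ _ X mX)).

Lemma ge0_integral_law d' (U : measurableType d') (X : T -> U)
    (mX : measurable_fun setT X) (h : U -> \bar R) :
  measurable_fun setT h -> (forall x, 0 <= h x) ->
  \int[P]_w h (X w) = \int[law mX]_x h x.
Proof. by move=> mh h0; rewrite /law ge0_integral_distribution. Qed.

(** The law of the pair agrees with the product of the laws on rectangles, hence everywhere;
    Tonelli's theorem then iterates the integral. *)
Lemma ge0_integral_independent d1 d2 (T1 : measurableType d1)
    (T2 : measurableType d2) (X : T -> T1) (Y : T -> T2)
    (mX : measurable_fun setT X) (mY : measurable_fun setT Y)
    (h : T1 * T2 -> \bar R) :
  (forall A B, measurable A -> measurable B ->
    P (X @^-1` A `&` Y @^-1` B) = P (X @^-1` A) * P (Y @^-1` B)) ->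
  measurable_fun setT h -> (forall x, 0 <= h x) ->
  \int[P]_w h (X w, Y w) = \int[law mX]_x \int[law mY]_y h (x, y).
Proof.
move=> XY mh h0.
have mXY : measurable_fun setT (fun w => (X w, Y w)) by exact: measurable_fun_pair.
rewrite (ge0_integral_law mXY)//.
rewrite -[RHS](fubini_tonelli1 (m1 := law mX) (m2 := law mY) _ mh h0).
apply: eq_measure_integral => A mA _.
by apply/esym/product_measure_unique => // B C mB mC; rewrite /= -XY.
Qed.

(** The image under [X] of [P] restricted to [E] is [P E] times the law of [X]. *)
Lemma ge0_integral_independent_set d' (U : measurableType d') (X : T -> U)
    (E : set T) (h : U -> \bar R) :
  measurable_fun setT X -> measurable E ->
  (forall A, measurable A -> P (E `&` X @^-1` A) = P E * P (X @^-1` A)) ->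
  measurable_fun setT h -> (forall x, 0 <= h x) ->
  \int[P]_(w in E) h (X w) = P E * \int[P]_w h (X w).
Proof.
move=> mX mE EX mh h0.
have mhX : measurable_fun setT (h \o X) by exact: measurableT_comp.
transitivity (\int[mrestr P mE]_w h (X w)).
  rewrite (@ge0_integral_density _ _ _ P (mrestr P mE) (\1_E))//; last first.
    by move=> A mA; rewrite /= /mrestr integral_indic// setIC.
  rewrite [LHS]integral_mkcond; apply: eq_integral => w _.
  by rewrite patchE indicE; case: (w \in E); rewrite ?mule1 ?mule0.
have PE : P E = (fine (P E))%:E by rewrite fineK// fin_num_measure.
have PE0 : (0 <= fine (P E))%R by exact: fine_ge0.
transitivity (\int[image_measure (mrestr P mE) mX]_x h x).
  by rewrite ge0_integral_pushforward.
rewrite (eq_measure_integral (mscale (NngNum PE0) (law mX))); last first.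
  move=> A mA _.
  by rewrite /= /mscale /= /pushforward /mrestr setIC EX// {1}PE.
by rewrite ge0_integral_mscale// -PE (ge0_integral_law mX).
Qed.

(** Both sides are finite measures in [E]; agreeing on the pi-system [C], they agree on the
    sigma-algebra it generates. *)
Lemma independent_g_sigma (C : set (set T)) (F : set T) :
  setI_closed C -> C `<=` measurable -> C setT -> measurable F ->
  (forall E, C E -> P (E `&` F) = P E * P F) ->
  forall E, <<s C >> E -> P (E `&` F) = P E * P F.
Proof.
move=> CI Cm CT mF CF E CE.
have PF : P F = (fine (P F))%:E by rewrite fineK// fin_num_measure.
have PF0 : (0 <= fine (P F))%R by exact: fine_ge0.
have -> : P (E `&` F) = mscale (NngNum PF0) P E.
  apply: (@g_sigma_algebra_measure_unique _ _ _ C Cm (fun=> setT) (fun=> CT) _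
    (mrestr P mF)) => //.
  - by rewrite bigcup_const.
  - by move=> A CA; rewrite /= /mrestr CF// muleC [X in X * _]PF.
  - by move=> _; rewrite /= /mrestr setTI PF ltry.
by rewrite muleC [X in _ = X * _]PF.
Qed.

(** With [<<s C >>] as the measurable structure on [T], this is the measurability of a finite
    sum. *)
Lemma g_sigma_sum (C : set (set T)) (G : nat -> T -> R) n :
  (forall i, (i < n)%N -> forall B, measurable B -> <<s C >> (G i @^-1` B)) ->
  forall A : set R, measurable A ->
  <<s C >> ((fun w => \sum_(0 <= i < n) G i w)%R @^-1` A).
Proof.
move=> GC A mA.
have mG (i : nat) : (i < n)%N ->
    @measurable_fun _ _ (g_sigma_algebraType C) R setT (G i).
  by move=> lin _ B mB; rewrite setTI; exact: GC.
suff : @measurable_fun _ _ (g_sigma_algebraType C) R setT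
    (fun w => \sum_(i < n) G i w)%R.
  move=> /(_ measurableT A mA); rewrite setTI.
  by under eq_fun do rewrite -(big_mkord xpredT (fun i => G i _)).
by apply: measurable_sum => i; exact: mG.
Qed.

Variable G : nat -> {RV P >-> R}.
Hypothesis Gind : independent P
  (fun n : nat => preimage_set_system setT (G n) measurable).

(** Intersections of events of the first [n] variables form a pi-system. By the product rule its
    members are independent of [G n], and it generates a sigma-algebra containing the events of the
    partial sum. *)
Lemma independent_partial_sum n (A B : set R) : measurable A -> measurable B ->
  P ((fun w => \sum_(0 <= i < n) G i w)%R @^-1` A `&` G n @^-1` B) =
  P ((fun w => \sum_(0 <= i < n) G i w)%R @^-1` A) * P (G n @^-1` B).
Proof.
move=> mA mB.
pose S (i : nat) := preimage_set_system setT (G i) measurable.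
have Sm i E : S i E -> measurable E.
  by move=> [D mD <-]; exact: measurable_funP.
have SI i E F : S i E -> S i F -> S i (E `&` F).
  move=> [D mD <-] [D' mD' <-]; exists (D `&` D'); first exact: measurableI.
  by rewrite !setTI.
have ST i : S i setT by exists setT => //; rewrite setTI.
pose C : set (set T) := [set E | exists2 D : nat -> set T,
  forall i, S i (D i) & E = \big[setI/setT]_(i <- iota 0 n) D i].
apply: (@independent_g_sigma C).
- move=> _ _ [D SD ->] [D' SD' ->]; exists (fun i => D i `&` D' i).
    by move=> i; exact: SI.
  by rewrite big_split.
- move=> _ [D SD ->]; apply: bigsetI_measurable => i _; exact: Sm (SD i).
- by exists (fun=> setT) => //; rewrite big1.
- exact: measurable_funPTI.
- move=> _ [D SD ->].
  (* Placing the event of [G n] at index [n] turns the claim into the product rule over 0, ..., n,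
     split at the last index. *)
  pose D' i := if (i < n)%N then D i else G n @^-1` B.
  have SD' i : S i (if (i <= n)%N then D' i else setT).
    case: ifPn => // ilen; rewrite /D'; case: ifPn => // ; rewrite -leqNgt => nlei.
    have -> : i = n by apply/eqP; rewrite eqn_leq ilen.
    by exists B => //; rewrite setTI.
  have DD' : \big[setI/setT]_(i <- iota 0 n) D' i = \big[setI/setT]_(i <- iota 0 n) D i.
    by apply: eq_big_seq => i; rewrite mem_iota /D' => /andP[_ ->].
  have D'n : D' n = G n @^-1` B by rewrite /D' ltnn.
  have SD'' i : i \in iota 0 n.+1 -> S i (D' i).
    by rewrite mem_iota ltnS => /andP[_ ilen]; have := SD' i; rewrite ilen.
  have := @Gind (iota 0 n.+1) D' (iota_uniq _ _) SD''.
  rewrite -addn1 iotaD !big_cat !big_seq1/= add0n DD' D'n => ->.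
  congr (_ * _).
  rewrite [RHS](@Gind (iota 0 n) D) ?iota_uniq//.
  by apply: eq_big_seq => i; rewrite mem_iota /D' => /andP[_ ->].
  by move=> i _; exact: SD.
- apply: (@g_sigma_sum C (fun i => G i : T -> R) n _ A mA) => i lin D mD.
  apply: sub_sigma_algebra.
  exists (fun j => if j == i then G i @^-1` D else setT).
    move=> j; case: eqP => [->|//]; exists D => //; by rewrite setTI.
  rewrite (bigD1_seq i)/= ?iota_uniq ?mem_iota// eqxx big1 ?setIT//.
  by move=> j /negbTE ->.
Qed.

End independence.

(** * Gamma laws *)

Section gamma_law.
Context d (T : measurableType d) (R : realType) (P : probability T R).
Local Open Scope ereal_scope.
Local Notation mu := (@lebesgue_measure R).
Implicit Types (p q b : R) (X Y : T -> R).

Lemma gamma_pdf_ge0 p b x : (0 <= gamma_pdf p b x :> R)%R.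
Proof.
rewrite gamma_pdfE mulr_ge0 ?gamma_kernel_ge0// divr_ge0 ?powR_ge0//.
rewrite gamma_fun_kernel fine_ge0// integral_ge0// => y _.
by rewrite lee_fin gamma_kernel_ge0.
Qed.

Lemma measurable_gamma_pdf p b : measurable_fun [set: R] (gamma_pdf p b).
Proof.
rewrite (_ : gamma_pdf p b = fun x => b `^ p / gamma_fun p * gamma_kernel p b x)%R.
  by apply: measurable_funM => //; exact: measurable_gamma_kernel.
by apply/funext => x; exact: gamma_pdfE.
Qed.

(** Counterpart of [gamma_distributed] for bare functions, such as partial sums. *)
Definition gamma_law p b X := forall A : set R, measurable A ->
  P (X @^-1` A) = \int[mu]_(x in A) (gamma_pdf p b x)%:E.

Lemma ge0_integral_gamma_law p b X (h : R -> \bar R) :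
  measurable_fun setT X -> gamma_law p b X ->
  measurable_fun [set: R] h -> (forall x, 0 <= h x) ->
  \int[P]_w h (X w) = \int[mu]_x (h x * (gamma_pdf p b x)%:E).
Proof.
move=> mX Xg mh h0.
have mX' : @measurable_fun _ _ T (measurableTypeR R) setT X by exact: mX.
rewrite (ge0_integral_law P mX')//.
apply: (@ge0_integral_density _ _ _ mu (law P mX')) => //.
- exact: measurable_gamma_pdf.
- exact: gamma_pdf_ge0.
Qed.

Lemma integral_gamma_pdf p b (A : set R) : measurable A ->
  \int[mu]_(x in A) (gamma_pdf p b x)%:E =
  (b `^ p / gamma_fun p)%:E * \int[mu]_x ((\1_A x)%:E * (gamma_kernel p b x)%:E).
Proof.
move=> mA.
have mk : measurable_fun [set: R] (fun x => (gamma_kernel p b x)%:E).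
  by apply/measurable_EFinP; exact: measurable_gamma_kernel.
transitivity (\int[mu]_(x in A) ((b `^ p / gamma_fun p)%:E * (gamma_kernel p b x)%:E)).
  by apply: eq_integral => x _; rewrite gamma_pdfE EFinM.
rewrite ge0_integralZl_EFin//; last 3 first.
- by move=> x _; rewrite lee_fin gamma_kernel_ge0.
- exact: measurable_funTS.
- rewrite divr_ge0 ?powR_ge0// gamma_fun_kernel fine_ge0// integral_ge0// => y _.
  by rewrite lee_fin gamma_kernel_ge0.
congr (_ * _); rewrite integral_mkcond; apply: eq_integral => x _.
by rewrite patchE indicE; case: (x \in A); rewrite ?mul1e ?mul0e.
Qed.

(* The existence of a gamma law entails that the gamma integral converges:
   otherwise [gamma_fun p] would be [0] and the density would vanish. *)
Lemma gamma_law_integral p b X : (0 < b)%R -> gamma_law p b X ->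
  \int[mu]_x (gamma_kernel p 1 x)%:E = (gamma_fun p)%:E /\ (0 < gamma_fun p)%R.
Proof.
move=> b0 /(_ setT measurableT); rewrite preimage_setT probability_setT.
rewrite integral_gamma_pdf//.
under eq_integral do rewrite indicT mul1e.
rewrite (integral_gamma_kernel p b0) gamma_fun_kernel.
have : 0 <= \int[mu]_x (gamma_kernel p 1 x)%:E.
  by apply: integral_ge0 => x _; rewrite lee_fin gamma_kernel_ge0.
case: (\int[mu]_x _) => [r| |]//=.
- rewrite lee_fin le_eqVlt => /orP[/eqP <-|r0 _]; last by split.
  by rewrite !mule0 => -[] /eqP; rewrite oner_eq0.
- by rewrite invr0 mulr0 mul0e => _ [] /eqP; rewrite oner_eq0.
Qed.

(** By convolution the law of the sum is a constant [K] times the kernel of shape p + q; total mass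
    1 then forces [K] to be the normalising constant. *)
Lemma gamma_lawD p q b X Y : (0 < b)%R ->
  measurable_fun setT X -> measurable_fun setT Y ->
  gamma_law p b X -> gamma_law q b Y ->
  (forall A B : set R, measurable A -> measurable B ->
    P (X @^-1` A `&` Y @^-1` B) = P (X @^-1` A) * P (Y @^-1` B)) ->
  gamma_law (p + q) b (fun w => X w + Y w)%R.
Proof.
move=> b0 mX mY Xg Yg XY.
have mX' : @measurable_fun _ _ T (measurableTypeR R) setT X by exact: mX.
have mY' : @measurable_fun _ _ T (measurableTypeR R) setT Y by exact: mY.
pose k r x : \bar R := (gamma_kernel r b x)%:E.
have mk r : measurable_fun [set: R] (k r).
  by apply/measurable_EFinP; exact: measurable_gamma_kernel.
have k0 r x : 0 <= k r x by rewrite lee_fin gamma_kernel_ge0.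
pose c r : R := (b `^ r / gamma_fun r)%R.
have c0 r : (0 <= c r)%R.
  rewrite divr_ge0 ?powR_ge0// gamma_fun_kernel fine_ge0// integral_ge0// => y _.
  by rewrite lee_fin gamma_kernel_ge0.
have [K KE] : exists K, forall A : set R, measurable A ->
    P ((fun w => X w + Y w)%R @^-1` A) = K * \int[mu]_z ((\1_A z)%:E * k (p + q)%R z).
  (* The two normalising constants, and the beta integral produced by the convolution. *)
  exists ((c q)%:E * (c p)%:E * beta_integral p q) => A mA.
  have mh : measurable_fun [set: R] (EFin \o \1_A : R -> \bar R).
    by apply/measurable_EFinP; exact: measurable_indic.
  have h0 x : 0 <= (EFin \o \1_A : R -> \bar R) x by rewrite lee_fin.
  transitivity (\int[P]_w (\1_A (X w + Y w)%R)%:E).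
    have mXY : measurable ((fun w => X w + Y w)%R @^-1` A).
      by rewrite -[_ @^-1` _]setTI; apply: measurable_funD.
    by rewrite -[X in P X]setIT -integral_indic.
  pose f (u : R * R) : \bar R := (\1_A (u.1 + u.2)%R)%:E.
  have mf : measurable_fun [set: R * R] f.
    apply: (measurableT_comp mh).
    by apply: measurable_funD; [exact: measurable_fst|exact: measurable_snd].
  have f0 u : 0 <= f u by rewrite lee_fin.
  have mF : measurable_fun [set: R * R] (fun u => f u * k q u.2).
    by apply: emeasurable_funM => //; apply: measurableT_comp => //;
      exact: measurable_snd.
  have F0 u : 0 <= f u * k q u.2 by rewrite mule_ge0.
  pose H x : \bar R := \int[mu]_y (f (x, y) * k q y).
  have mH : measurable_fun [set: R] H.
    exact: (@measurable_fun_fubini_tonelli_F _ _ _ _ _ mu _ mF F0).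
  have H0 x : 0 <= H x by apply: integral_ge0 => y _; exact: F0.
  transitivity (\int[law P mX']_x \int[law P mY']_y f (x, y)).
    exact: (ge0_integral_independent (P := P) (h := f) mX' mY').
  transitivity (\int[law P mX']_x ((c q)%:E * H x)).
    apply: eq_integral => x _.
    have mfx : measurable_fun [set: R] (fun y => f (x, y)).
      exact: (measurable_fun_pair2 x mf).
    rewrite -(ge0_integral_law P mY' mfx (fun y => f0 (x, y))).
    rewrite (@ge0_integral_gamma_law q b Y (fun y => f (x, y)))//.
    rewrite /H -ge0_integralZl_EFin//.
    - by apply: eq_integral => y _; rewrite gamma_pdfE EFinM muleCA.
    - exact: (measurable_fun_pair2 x mF).
  have mcH : measurable_fun [set: R] (fun x => (c q)%:E * H x).
    exact: emeasurable_funM.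
  have cH0 x : 0 <= (c q)%:E * H x by rewrite mule_ge0// lee_fin.
  rewrite -(ge0_integral_law P mX' mcH cH0).
  rewrite (@ge0_integral_gamma_law p b X (fun x => (c q)%:E * H x))//.
  rewrite -muleA -(integral_gamma_kernelD p q b mh h0) -EFinM.
  rewrite -ge0_integralZl_EFin//.
  - apply: eq_integral => x _; rewrite gamma_pdfE !EFinM.
    by rewrite muleACA.
  - by move=> x _; exact: (mule_ge0 (H0 x) (k0 p x)).
  - exact: (emeasurable_funM mH (mk p)).
  - exact: mulr_ge0.
have := KE setT measurableT.
rewrite preimage_setT probability_setT.
under eq_integral do rewrite indicT mul1e.
rewrite (integral_gamma_kernel _ b0) => KI A mA.
rewrite KE// integral_gamma_pdf// /c; congr (_ * _).
have bpq : (0 < b `^ (- (p + q)))%R by rewrite powR_gt0.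
move: KI; rewrite gamma_fun_kernel.
have : 0 <= \int[mu]_x (gamma_kernel (p + q) 1 x)%:E.
  by apply: integral_ge0 => x _; rewrite lee_fin gamma_kernel_ge0.
(* [K] times b^(-(p + q)) times this integral is 1. Hence neither [K] nor the integral is zero or
   infinite, and the equation can be solved for [K]. *)
case: (\int[mu]_x _) => [r| |]//= r0.
- rewrite -EFinM; case: K {KE} => [K| |]/=.
  + rewrite -EFinM => -[] /esym K1; congr EFin.
    have r0' : r != 0%R.
      by apply/eqP => r0'; move: K1 => /eqP; rewrite r0' !mulr0 eq_sym oner_eq0.
    have /(congr1 (fun x => x * (b `^ (p + q) / r)))%R := K1.
    rewrite mul1r => <-; rewrite powRN.
    by field; rewrite r0' gt_eqF// powR_gt0.
  + have [->|r0'] := eqVneq r 0%R; first by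
      rewrite mulr0 mule0 => -[]/eqP; rewrite oner_eq0.
    by rewrite gt0_mulye// lte_fin mulr_gt0// lt0r r0'.
  + have [->|r0'] := eqVneq r 0%R; first by
      rewrite mulr0 mule0 => -[]/eqP; rewrite oner_eq0.
    by rewrite gt0_mulNye// lte_fin mulr_gt0// lt0r r0'.
- rewrite gt0_muley ?lte_fin//; case: (ltgtP 0 K) => [K0|K0|<-].
  + by rewrite gt0_muley.
  + by rewrite lt0_muley.
  + by rewrite mul0e => -[] /eqP; rewrite oner_eq0.
Qed.

(** Induction on the number of summands, starting from one: the empty sum has no density. *)
Lemma gamma_law_partial_sum p b (G : nat -> {RV P >-> R}) : (0 < b)%R ->
  (forall n, gamma_distributed p b (G n)) ->
  independent P (fun n : nat => preimage_set_system setT (G n) measurable) ->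
  forall n, gamma_law (p * n.+1%:R) b (fun w => \sum_(0 <= i < n.+1) G i w)%R.
Proof.
move=> b0 Gg Gind; elim=> [|n IHn].
  under eq_fun do rewrite big_nat1.
  by rewrite mulr1; exact: Gg.
under eq_fun do rewrite big_nat_recr//=.
rewrite -[n.+2]addn1 natrD mulrDr mulr1.
apply: gamma_lawD => //.
- by under eq_fun do rewrite big_mkord; exact: measurable_sum.
- exact: Gg.
- by move=> A B mA mB; exact: (independent_partial_sum Gind).
Qed.

End gamma_law.

(** * Poisson processes at an independent random time *)

Section poisson_mass.
Context {R : realType}.
Implicit Types u : R.

(* [poisson_pmf 0] is constantly [1]; this variant is right at [0]. *)
Definition poisson_mass u k : R := u ^+ k * k`!%:R^-1 * expR (- u).

Lemma poisson_mass_ge0 u k : 0 <= u -> 0 <= poisson_mass u k.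
Proof. by move=> u0; rewrite !mulr_ge0 ?expR_ge0 ?exprn_ge0 ?invr_ge0. Qed.

Lemma continuous_poisson_mass k : continuous (fun u => poisson_mass u k).
Proof.
move=> u; apply: cvgM; first apply: cvgM.
- exact: exprn_continuous.
- exact: cvg_cst.
- apply: (@continuous_comp _ _ _ -%R expR); first exact: oppr_continuous.
  exact: continuous_expR.
Qed.

Lemma measurable_poisson_mass k : measurable_fun [set: R] (fun u => poisson_mass u k).
Proof. by apply: continuous_measurable_fun; exact: continuous_poisson_mass. Qed.

End poisson_mass.

(** * Approximating a time from the right by grid points *)

Section grid.
Context {R : realType}.
Implicit Types x : R.

(** First multiple of 1/(n+1) strictly after max(x, 0). Strictness suits right limits; the maximum
    reflects that the processes vanish at nonpositive times. *)
Definition grid n x : R := (Num.truncn (n.+1%:R * Num.max x 0)).+1%:R / n.+1%:R.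

Lemma grid_gt n x : Num.max x 0 < grid n x.
Proof. by rewrite /grid ltr_pdivlMr// mulrC truncnS_gt. Qed.

Lemma grid_gt0 n x : 0 < grid n x.
Proof. by rewrite (le_lt_trans _ (grid_gt n x))// le_max lexx orbT. Qed.

Lemma grid_le n x : grid n x <= Num.max x 0 + n.+1%:R^-1.
Proof.
rewrite /grid ler_pdivrMr// mulrDl mulVf// -natr1 lerD2r mulrC.
by rewrite truncn_le// mulr_ge0// le_max lexx orbT.
Qed.

Lemma grid_cvg x : grid n x @[n --> \oo] --> Num.max x 0.
Proof.
apply: (@squeeze_cvgr _ _ _ _ (fun=> Num.max x 0) (fun n => Num.max x 0 + n.+1%:R^-1)).
- by apply: nearW => n; rewrite grid_le ltW ?grid_gt.
- exact: cvg_cst.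
- rewrite -[X in _ --> X]addr0; apply: cvgD; first exact: cvg_cst.
  exact: cvg_harmonic.
Qed.

(** The set on which [grid n] takes the constant value (j+1)/(n+1). *)
Definition cell n j : set R :=
  (fun x => n.+1%:R * Num.max x 0) @^-1` `[j%:R, j.+1%:R[.

Lemma measurable_cell n j : measurable (cell n j).
Proof.
rewrite -[cell n j]setTI.
have : measurable_fun [set: R] (fun x => n.+1%:R * Num.max x 0).
  by apply: measurable_funM => //; exact: measurable_maxr.
by apply.
Qed.

Lemma cellP n j x : cell n j x <-> Num.truncn (n.+1%:R * Num.max x 0) = j.
Proof.
have x0 : 0 <= n.+1%:R * Num.max x 0 by rewrite mulr_ge0// le_max lexx orbT.
rewrite /cell /= in_itv/=; split; first exact: truncn_def.
by move=> /eqP; rewrite truncn_eq.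
Qed.

Lemma bigcup_cell n : \bigcup_j cell n j = setT.
Proof.
apply/seteqP; split => // x _.
by exists (Num.truncn (n.+1%:R * Num.max x 0)) => //; apply/cellP.
Qed.

Lemma trivIset_cell n : trivIset setT (cell n).
Proof.
apply/trivIsetP => i j _ _ /eqP ij; apply/seteqP; split => // x [/cellP xi /cellP xj].
by apply: ij; rewrite -xi -xj.
Qed.

End grid.

(** * Joint law of two Poisson processes at an independent random time *)

Section poisson_random_time.
Context d (T : measurableType d) (R : realType) (P : probability T R).
Implicit Types (lam t : R) (N : R -> {RV P >-> nat}).

Lemma poisson_process_mass lam N t k : 0 < lam -> poisson_process lam N ->
  0 <= t -> P [set w | N t w = k] = (poisson_mass (lam * t) k)%:E.
Proof.
move=> lam0 [N0 _ _ _ NP]; rewrite le_eqVlt => /orP[/eqP <-|t0].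
  rewrite (_ : [set _ | _] = [set _ | 0%N = k]); last first.
    by apply/seteqP; split => w /=; rewrite N0.
  rewrite mulr0 /poisson_mass oppr0 expR0 mulr1; case: k => [|k].
    rewrite (_ : [set _ | _] = setT); last by apply/seteqP; split.
    by rewrite probability_setT expr0 fact0 invr1 mulr1.
  rewrite (_ : [set _ | _] = set0); last by apply/seteqP; split.
  by rewrite measure0 expr0n/= mul0r.
have := NP 0 t k (lexx _) t0; rewrite subr0 /poisson_pmf mulr_gt0// => <-.
by congr (P _); apply/seteqP; split => w /=; rewrite (N0 w 0)// subn0.
Qed.

(** A right limit in a discrete space is eventually attained, and the grid points approach max(x, 0)
    strictly from the right. *)
Lemma poisson_process_grid lam N w x : poisson_process lam N ->
  \forall n \near \oo, N (grid n x) w = N x w.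
Proof.
move=> [N0 _ Nr _ _].
have -> : N x w = N (Num.max x 0) w.
  by case: (leP x 0) => // x0; rewrite !N0.
have /discrete_cvg := Nr w (Num.max x 0); rewrite /= => NE.
have : \forall n \near \oo,
    Num.max x 0 < grid n x -> N (grid n x) w = N (Num.max x 0) w.
  exact: (@grid_cvg _ x _ NE).
by apply: filterS => n; apply; exact: grid_gt.
Qed.

Section two_processes.
Variables (lam1 lam2 : R) (N1 N2 : R -> {RV P >-> nat}) (X : {RV P >-> R}).
Hypotheses (lam1_gt0 : 0 < lam1) (lam2_gt0 : 0 < lam2).
Hypotheses (N1P : poisson_process lam1 N1) (N2P : poisson_process lam2 N2).
Hypothesis N1N2X : forall s m k (A : set R), measurable A ->
  P ([set w | N1 s w = m] `&` [set w | N2 s w = k] `&` X @^-1` A) =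
  (P [set w | N1 s w = m] * P [set w | N2 s w = k] * P (X @^-1` A))%E.
Variables (m k : nat).
Local Open Scope ereal_scope.

(** Joint mass of [N1 s] and [N2 s] at [m] and [k], for a fixed time [s >= 0]. *)
Let q (s : R) : R := (poisson_mass (lam1 * s) m * poisson_mass (lam2 * s) k)%R.

Let E := [set w | N1 (X w) w = m /\ N2 (X w) w = k].

Let E_ n := [set w | N1 (grid n (X w)) w = m /\ N2 (grid n (X w)) w = k].

Let mN (N : R -> {RV P >-> nat}) s j : measurable [set w | N s w = j].
Proof.
by have := @measurable_funPTI _ _ _ _ (N s) [set j]; apply.
Qed.

Let mXcell n j : measurable (X @^-1` cell n j).
Proof. by apply: measurable_funPTI; exact: measurable_cell. Qed.

Let grid_cell n j w : (X @^-1` cell n j) w -> grid n (X w) = (j.+1%:R / n.+1%:R)%R.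
Proof. by move=> /cellP Xw; rewrite /grid Xw. Qed.

(** On a cell the random time is frozen at a grid point, which brings the event into the form
    required by [N1N2X]. *)
Let E_cell n j : E_ n `&` X @^-1` cell n j =
  [set w | N1 (j.+1%:R / n.+1%:R)%R w = m] `&`
  [set w | N2 (j.+1%:R / n.+1%:R)%R w = k] `&` X @^-1` cell n j.
Proof.
apply/seteqP; split => w /= [+ cw]; rewrite /E_/= (grid_cell cw);
  by move=> [? ?].
Qed.

Let bigcup_Xcell n : \bigcup_j (X @^-1` cell n j) = setT.
Proof. by rewrite -preimage_bigcup bigcup_cell preimage_setT. Qed.

Let mE_ n : measurable (E_ n).
Proof.
rewrite -[E_ n]setIT -(bigcup_Xcell n) setI_bigcupr.
apply: bigcupT_measurable => j; rewrite E_cell.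
by apply: measurableI => //; exact: measurableI.
Qed.

Let q_ge0 s : (0 <= s)%R -> (0 <= q s)%R.
Proof.
by move=> s0; rewrite mulr_ge0// poisson_mass_ge0// mulr_ge0// ltW.
Qed.

Let q_le1 s : (0 <= s)%R -> (q s <= 1)%R.
Proof.
move=> s0; rewrite -lee_fin EFinM -(poisson_process_mass _ lam1_gt0 N1P s0).
rewrite -(poisson_process_mass _ lam2_gt0 N2P s0).
by rewrite -[leRHS]mule1; apply: lee_pmul; rewrite ?measure_ge0 ?probability_le1.
Qed.

Let continuous_q : continuous q.
Proof.
move=> s.
have c l j : poisson_mass (l * x)%R j @[x --> s] --> poisson_mass (l * s)%R j.
  apply: (@cvg_comp _ _ _ ( *%R l) (fun u => poisson_mass u j)).
    exact: mulrl_continuous.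
  exact: continuous_poisson_mass.
by apply: cvgM; exact: c.
Qed.

Let mq : measurable_fun [set: R] q.
Proof. by apply: continuous_measurable_fun; exact: continuous_q. Qed.

Let mgrid n : measurable_fun [set: T] (fun w => grid n (X w)).
Proof.
move=> _ B mB; rewrite setTI.
have -> : (fun w => grid n (X w)) @^-1` B = \bigcup_j
    (X @^-1` cell n j `&` [set w | B (j.+1%:R / n.+1%:R)%R]).
  apply/seteqP; split => w /=.
    move=> Bw; exists (Num.truncn (n.+1%:R * Num.max (X w) 0)%R) => //.
    have cw : (X @^-1` cell n (Num.truncn (n.+1%:R * Num.max (X w) 0)%R)) w.
      exact/cellP.
    by split => //=; rewrite -(grid_cell cw).
  by move=> [j _ [cw]] /=; rewrite (grid_cell cw).
apply: bigcupT_measurable => j; apply: measurableI => //.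
have [Bj|nBj] := pselect (B (j.+1%:R / n.+1%:R)%R).
  by rewrite (_ : [set _ | _] = setT)//; apply/seteqP; split.
by rewrite (_ : [set _ | _] = set0)//; apply/seteqP; split.
Qed.

Let mq_grid n : measurable_fun [set: T] (fun w => (q (grid n (X w)))%:E).
Proof. by apply/measurable_EFinP; apply: (measurableT_comp mq). Qed.

(** Summation over the cells, on each of which the product rule factors the probability. *)
Let P_grid n : P (E_ n) = \int[P]_w (q (grid n (X w)))%:E.
Proof.
have tr : trivIset setT (fun j => X @^-1` cell n j).
  apply/trivIsetP => i j _ _ ij; rewrite -preimage_setI.
  by move/trivIsetP : (@trivIset_cell R n) => -> //; rewrite preimage_set0.
have split_cells (f : T -> \bar R) : measurable_fun setT f -> (forall w, 0 <= f w) ->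
    \int[P]_w f w = \sum_(0 <= j <oo) \int[P]_(w in X @^-1` cell n j) f w.
  move=> mf f0; rewrite -[in LHS](bigcup_Xcell n) ge0_integral_bigcup//.
  exact: measurable_funTS.
have mI : measurable_fun setT (fun w => (\1_(E_ n) w)%:E : \bar R).
  by apply/measurable_EFinP; exact: measurable_indic.
have q0 w : 0 <= (q (grid n (X w)))%:E by rewrite lee_fin q_ge0// ltW// grid_gt0.
rewrite -[X in P X]setIT -integral_indic// (split_cells _ (mq_grid n) q0).
rewrite (split_cells _ mI); last by move=> w; rewrite lee_fin.
apply: eq_eseriesr => j _.
rewrite integral_indic// E_cell.
apply: etrans (N1N2X _ m k (measurable_cell n j)) _.
have s0 : (0 <= j.+1%:R / n.+1%:R :> R)%R by [].
rewrite (poisson_process_mass _ lam1_gt0 N1P s0) (poisson_process_mass _ lam2_gt0 N2P s0).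
rewrite -integral_cst//.
by apply: eq_integral => w /set_mem/grid_cell ->.
Qed.

Let indic_cvg w : (\1_(E_ n) w : R) @[n --> \oo] --> (\1_E w : R).
Proof.
apply: cvg_near_cst.
have h1 := poisson_process_grid w (X w) N1P.
have h2 := poisson_process_grid w (X w) N2P.
near=> n; rewrite !indicE; congr (_%:R); congr nat_of_bool.
apply/idP/idP => /set_mem; rewrite /E/E_/= => -[e1 e2]; apply/mem_set; rewrite /E/E_/=.
  by rewrite -e1 -e2; split; apply/esym; near: n.
by rewrite -e1 -e2; split; near: n.
Unshelve. all: by end_near.
Qed.

(** The indicator of [E] is the pointwise limit of those of the [E_ n]. *)
Lemma measurable_poisson_random_time : measurable E.
Proof.
apply/(@measurable_indicP _ _ R); apply: measurable_fun_cvg => [n|w _].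
- exact: measurable_indic (mE_ n).
- exact: indic_cvg.
Qed.

(** Limit of [P_grid], dominated by 1 on both sides: the left converges through the indicators, the
    right through the continuity of [q]. *)
Lemma poisson_random_time : P E = \int[P]_w
  (poisson_mass (lam1 * Num.max (X w) 0%R) m *
   poisson_mass (lam2 * Num.max (X w) 0%R) k)%:E.
Proof.
have mE := measurable_poisson_random_time.
have i1 : P.-integrable setT (cst 1 : T -> \bar R).
  exact: finite_measure_integrable_cst.
have h1 : P (E_ n) @[n --> \oo] --> P E.
  rewrite -[X in _ --> P X]setIT -integral_indic//.
  under eq_fun do rewrite -[X in P X]setIT -integral_indic//.
  apply: (dominated_cvg measurableT _ _ _ i1) => //.
  - by move=> n; apply/measurable_EFinP; exact: measurable_indic.
  - by move=> w _; apply: cvg_EFin; [exact: nearW|exact: indic_cvg].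
  - by move=> n w _; rewrite /= lee_fin indicE; case: (_ \in _); rewrite ?normr1 ?normr0.
have h2 : P (E_ n) @[n --> \oo] --> \int[P]_w (q (Num.max (X w) 0%R))%:E.
  under eq_fun do rewrite P_grid.
  apply: (dominated_cvg measurableT _ _ _ i1) => //.
  - move=> w _; apply: cvg_EFin; first exact: nearW.
    apply: (@cvg_comp _ _ _ (fun n => grid n (X w)) q); first exact: grid_cvg.
    exact: continuous_q.
  - move=> n w _; have g0 := ltW (grid_gt0 n (X w)).
    by rewrite /= lee_fin ger0_norm ?q_le1 ?q_ge0.
exact: (cvg_unique _ h1 h2).
Qed.

End two_processes.

End poisson_random_time.

(** * Bessel, Wright and exponential series *)

Section series.
Context {R : realType}.
Local Open Scope ereal_scope.

Lemma nneseries_EFin (u : nat -> R) : cvgn (series u) ->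
  \sum_(0 <= n <oo) (u n)%:E = (limn (series u))%:E.
Proof.
move=> cu; rewrite -EFin_lim//; apply/congr_lim/funext => n /=.
by rewrite /series/= sumEFin.
Qed.

Lemma nneseries_exp (x : R) :
  \sum_(0 <= n <oo) (x ^+ n * n`!%:R^-1)%:E = (expR x)%:E.
Proof.
rewrite nneseries_EFin; last exact: is_cvg_series_exp_coeff.
by rewrite expRE /pseries; congr (limn (series _))%:E; apply/funext => n; rewrite mulrC.
Qed.

Lemma is_cvg_series_dominated_exp (u : nat -> R) (C x : R) : (0 <= x)%R ->
  (forall n, 0 <= u n <= C * (x ^+ n * n`!%:R^-1))%R -> cvgn (series u).
Proof.
move=> x0 uC; apply: (@series_le_cvg _ u (fun n => C * (x ^+ n * n`!%:R^-1))%R).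
- by move=> n; have /andP[] := uC n.
- by move=> n; have /andP[/le_trans + ] := uC n; apply.
- by move=> n; have /andP[] := uC n.
- apply: is_cvg_seriesZ; exact: is_cvg_series_exp_coeff.
Qed.

(** Generating function of the Poisson law, used for both processes and for the number of jumps. *)
Lemma poisson_mass_generating (u x : R) : (0 <= u)%R -> (0 <= x)%R ->
  \sum_(0 <= n <oo) (x ^+ n * poisson_mass u n)%:E = (expR (u * (x - 1)))%:E.
Proof.
move=> u0 x0.
transitivity (\sum_(0 <= n <oo) ((expR (- u))%:E * ((u * x) ^+ n * n`!%:R^-1)%:E)).
  apply: eq_eseriesr => n _; rewrite -EFinM; congr EFin.
  rewrite /poisson_mass exprMn; ring.
rewrite nneseriesZl; last first.
  by move=> n _; rewrite lee_fin mulr_ge0 ?invr_ge0// exprn_ge0// mulr_ge0.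
rewrite nneseries_exp -EFinM -expRD; congr (expR _)%:E; ring.
Qed.

End series.

(** * Convergence of the Wright and Bessel series, and Skellam's law *)

Section special_functions.
Context {R : realType}.
Local Open Scope ereal_scope.
Local Notation mu := (@lebesgue_measure R).

(* The factorial in the Wright series makes any positive lower bound on the
   gamma function sufficient for convergence. *)
Lemma gamma_fun_lower_bound (p : R) : (0 < p)%R ->
  \int[mu]_x (gamma_kernel p 1 x)%:E = (gamma_fun p)%:E ->
  (expR (- 2) / 2 <= gamma_fun p)%R.
Proof.
move=> p0 pE; rewrite -lee_fin -pE.
(* On [1, 2], which has length 1, x^(p-1) >= 1/x >= 1/2 because [p > 0], and e^(-x) >= e^(-2). *)
have -> : (expR (- 2) / 2)%:E = \int[mu]_(x in `[1%R, 2%R]) (expR (- 2) / 2)%:E :> \bar R.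
  rewrite integral_cst//= lebesgue_measure_itv/= lte_fin ltr1n.
  by rewrite -EFinB -EFinM; congr EFin; ring.
apply: (@le_trans _ _ (\int[mu]_(x in `[1%R, 2%R]) (gamma_kernel p 1 x)%:E)).
  apply: ge0_le_integral => //=.
  - by apply: measurable_funTS; apply/measurable_EFinP; exact: measurable_gamma_kernel.
  - move=> x; rewrite in_itv/= => /andP[x1 x2]; rewrite lee_fin /gamma_kernel.
    have x0 : (0 < x)%R by exact: lt_le_trans x1.
    rewrite x0 mul1r mulrC; apply: ler_pM; rewrite ?invr_ge0 ?expR_ge0//; last first.
      by rewrite ler_expR lerN2.
    rewrite powRD ?(gt_eqF x0) ?implybT// powR_inv1 ?(ltW x0)//.
    rewrite -[leLHS]mul1r ler_pM ?invr_ge0 ?lef_pV2 ?posrE//.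
    by rewrite -[leLHS](powRr0 x); apply: ler_powR => //; exact: ltW.
apply: ge0_subset_integral => //=.
- by apply/measurable_EFinP; exact: measurable_gamma_kernel.
- by move=> x _; rewrite lee_fin gamma_kernel_ge0.
Qed.

Lemma wright0_series (a z : R) : (0 < a)%R -> (0 <= z)%R ->
  (forall n, \int[mu]_x (gamma_kernel (a * n.+1%:R) 1 x)%:E =
             (gamma_fun (a * n.+1%:R))%:E) ->
  \sum_(0 <= n <oo) (z ^+ n.+1 / (n.+1`!%:R * gamma_fun (a * n.+1%:R)))%:E =
  (wright0 a z)%:E.
Proof.
move=> a0 z0 aE; rewrite nneseries_EFin//.
(* The factor [z] comes from the index shifted by one; the other factor bounds the inverse of the
   gamma function. *)
apply: (@is_cvg_series_dominated_exp _ _ (z * (expR (- 2) / 2)^-1)%R z) => // n.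
have e0 : (0 < expR (- 2) / 2 :> R)%R by rewrite divr_gt0 ?expR_gt0.
have g := gamma_fun_lower_bound (mulr_gt0 a0 (ltr0Sn R n)) (aE n).
have g0 := lt_le_trans e0 g.
rewrite divr_ge0 ?exprn_ge0 ?mulr_ge0 ?(ltW g0)//=.
rewrite exprS -!mulrA ler_wpM2l// mulrCA ler_wpM2l ?exprn_ge0//.
rewrite invfM mulrC ler_pM ?invr_ge0 ?(ltW g0)//.
  by rewrite lef_pV2 ?posrE.
by rewrite lef_pV2 ?posrE ?ltr0n ?fact_gt0// ler_nat factS leq_pmull.
Qed.

Lemma besselI_series (k : nat) (z : R) : (0 <= z)%R ->
  \sum_(0 <= n <oo) ((z / 2) ^+ (2 * n + k) / (n`!%:R * (n + k)`!%:R))%:E =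
  (besselI k z)%:E.
Proof.
move=> z0; rewrite nneseries_EFin//.
(* Since (n + k)! >= 1, the general term is at most (z/2)^k ((z/2)^2)^n / n!. *)
apply: (@is_cvg_series_dominated_exp _ _ ((z / 2) ^+ k)%R ((z / 2) ^+ 2)%R) => [|n].
  exact: sqr_ge0.
have z2 : (0 <= z / 2)%R by rewrite divr_ge0.
rewrite divr_ge0 ?exprn_ge0 ?mulr_ge0//= exprD exprM mulrAC mulrC.
rewrite ler_wpM2l ?exprn_ge0// ler_wpM2l ?exprn_ge0 ?sqr_ge0//.
rewrite lef_pV2 ?posrE ?mulr_gt0 ?ltr0n ?fact_gt0// ler_peMr//.
by rewrite ler1n fact_gt0.
Qed.

(** Skellam's law: the probability that independent Poisson variables of means l1 u and l2 u differ
    by [k]. As [p] or [r] is 0, the pairs (n + p, n + r) exhaust those with difference [k]. *)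
Lemma poisson_masses_besselI (l1 l2 u : R) (k : int) (p r : nat) :
  (0 < l1)%R -> (0 < l2)%R -> (0 <= u)%R ->
  k = (p%:Z - r%:Z)%R -> (p * r = 0)%N ->
  \sum_(0 <= n <oo)
    (poisson_mass (l1 * u) (n + p) * poisson_mass (l2 * u) (n + r))%:E =
  ((l1 / l2) `^ (k%:~R / 2) * (expR (- (u * (l1 + l2))) *
    besselI `|k|%N (2 * u * Num.sqrt (l1 * l2))))%:E.
Proof.
move=> l10 l20 u0 kE pr.
have s0 : (0 <= 2 * u * Num.sqrt (l1 * l2))%R by rewrite !mulr_ge0 ?sqrtr_ge0.
rewrite mulrA EFinM -besselI_series// -nneseriesZl; last first.
  by move=> n _; rewrite lee_fin divr_ge0 ?mulr_ge0// exprn_ge0// divr_ge0.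
apply: eq_eseriesr => n _; rewrite -EFinM; congr EFin.
rewrite (_ : 2 * u * _ / 2 = u * Num.sqrt (l1 * l2))%R; last first.
  by field.
have -> : Num.sqrt (l1 * l2) = (l1 `^ 2^-1 * l2 `^ 2^-1)%R.
  by rewrite -powRM ?ltW// powR12_sqrt// mulr_ge0 ?ltW.
have l12 : (l1 / l2 = (l1 `^ 2^-1 / l2 `^ 2^-1) ^+ 2)%R.
  by rewrite expr_div_n -!powR_mulrn ?powR_ge0// -!powRrM mulVf// !powRr1 ?ltW.
(* In terms of the square roots of [l1] and [l2] all exponents become natural numbers, within reach
   of [field]. *)
set x := (l1 `^ 2^-1)%R in l12 *; set y := (l2 `^ 2^-1)%R in l12 *.
have x0 : (0 < x)%R by rewrite powR_gt0.
have y0 : (0 < y)%R by rewrite powR_gt0.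
have l1E : l1 = (x ^+ 2)%R.
  by rewrite /x -powR_mulrn ?powR_ge0// -powRrM mulVf// powRr1// ltW.
have l2E : l2 = (y ^+ 2)%R.
  by rewrite /y -powR_mulrn ?powR_ge0// -powRrM mulVf// powRr1// ltW.
have -> : ((l1 / l2) `^ (k%:~R / 2) = x ^+ p / x ^+ r * (y ^+ r / y ^+ p))%R.
  rewrite l12 -powR_mulrn ?divr_ge0 ?ltW// -powRrM.
  rewrite mulrCA mulfV// mulr1 kE rmorphB/= powRD; last first.
    by rewrite (gt_eqF (divr_gt0 x0 y0)) implybT.
  rewrite powRN !powR_mulrn ?divr_ge0 ?ltW// !expr_div_n.
  by field; rewrite !expf_neq0 ?gt_eqF.
rewrite /poisson_mass.
have -> : expR (- (u * (l1 + l2))) = (expR (- (l1 * u)) * expR (- (l2 * u)))%R.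
  by rewrite -expRD; congr expR; ring.
rewrite {}l1E {}l2E {l12}.
have xy : x != 0%R /\ y != 0%R by rewrite !gt_eqF.
have f0 j : (j`!%:R != 0 :> R)%R by rewrite pnatr_eq0 -lt0n fact_gt0.
case: xy => x0' y0'.
move: pr => /eqP; rewrite muln_eq0 => /orP[/eqP p0|/eqP r0].
  move: kE; rewrite p0 sub0r => ->; rewrite abszN absz_nat addn0.
  rewrite !exprD !expr0 !exprMn; field.
  by rewrite !f0 ?expf_neq0.
move: kE; rewrite r0 subr0 => ->; rewrite absz_nat addn0.
rewrite !exprD !expr0 !exprMn; field.
by rewrite !f0 ?expf_neq0.
Qed.

End special_functions.

(** * Compound Poisson-gamma expectations *)

Section expectations.
Context d (T : measurableType d) (R : realType) (P : probability T R).
Local Open Scope ereal_scope.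
Local Notation mu := (@lebesgue_measure R).

Lemma ge0_integral_partition (D : set T) (F : nat -> set T) (f : T -> \bar R) :
  measurable D -> (forall n, measurable (F n)) -> trivIset setT F ->
  \bigcup_n F n = setT -> measurable_fun setT f -> (forall w, 0 <= f w) ->
  \int[P]_(w in D) f w = \sum_(0 <= n <oo) \int[P]_(w in D `&` F n) f w.
Proof.
move=> mD mF tF FT mf f0.
rewrite -[in LHS](setIT D) -FT setI_bigcupr ge0_integral_bigcup//.
- by move=> n; exact: measurableI.
- exact: measurable_funTS.
- exact: trivIset_setIl.
Qed.

Lemma trivIset_fibers (f : T -> nat) :
  trivIset setT (fun n => [set w | f w = n]).
Proof.
apply/trivIsetP => i j _ _ /eqP ij; apply/seteqP; split => // w /= [fi fj].
by apply: ij; rewrite -fi -fj.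
Qed.

Lemma bigcup_fibers (f : T -> nat) : \bigcup_n [set w | f w = n] = setT.
Proof. by apply/seteqP; split => // w _; exists (f w). Qed.

(** Expectation of [h] at a sum of [n] independent gamma variables; the empty sum is an atom at
    0. *)
Definition gamma_sum_integral (p b : R) (h : R -> \bar R) (n : nat) : \bar R :=
  if n is n'.+1 then
    \int[mu]_x (h x * (gamma_pdf (p * n'.+1%:R) b x)%:E)
  else h 0%R.

(** On the event of exactly [n] jumps, [X t] is the sum of the first [n] gamma variables, which is
    independent of that event. *)
Lemma compound_poisson_gamma_integral (lam p b t : R) (X : R -> {RV P >-> R})
    (h : R -> \bar R) :
  (0 < lam)%R -> (0 < b)%R -> (0 <= t)%R ->
  compound_poisson_gamma lam p b X ->
  measurable_fun [set: R] h -> (forall x, 0 <= h x) ->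
  \int[P]_w h (X t w) = \sum_(0 <= n <oo)
    ((poisson_mass (lam * t) n)%:E * gamma_sum_integral p b h n).
Proof.
move=> lam0 b0 t0 [N [G [NP Gg Gind NG XE]]] mh h0.
have mNn n : measurable [set w | N t w = n].
  by have := @measurable_funPTI _ _ _ _ (N t) [set n]; apply.
have mhX : measurable_fun setT (fun w => h (X t w)) by exact: (measurableT_comp mh).
have tN : trivIset setT (fun n => [set w | N t w = n]) by exact: trivIset_fibers.
rewrite (ge0_integral_partition measurableT mNn tN
  (bigcup_fibers _) mhX)//.
apply: eq_eseriesr => n _; rewrite setTI.
pose S w : R := (\sum_(0 <= i < n) G i w)%R.
have mS : measurable_fun setT S.
  by rewrite /S; under eq_fun do rewrite big_mkord; exact: measurable_sum.
transitivity (\int[P]_(w in [set w | N t w = n]) h (S w)).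
  by apply: eq_integral => w /set_mem/= Ntn; rewrite XE Ntn.
rewrite (ge0_integral_independent_set mS (mNn n) _ mh h0); last first.
  move=> A mA.
  have := NG [:: ord0; ord_max]
    (fun i : 'I_2 => if i == ord0 then [set w | N t w = n] else S @^-1` A).
  rewrite big_cons big_seq1 big_cons big_seq1/=; apply => //.
  move=> i; rewrite !inE => /orP[] /eqP -> /=; rewrite (tnth_nth set0)/=.
    apply: sub_sigma_algebra; exists t => //; exists [set n] => //.
    by rewrite setTI.
  apply: g_sigma_sum => // i' _ B mB; apply: sub_sigma_algebra.
  by exists i' => //; exists B => //; rewrite setTI.
rewrite (poisson_process_mass _ lam0 NP t0); congr (_ * _).
case: n => [|n] in S mS *.
  rewrite /= /S; under eq_integral do rewrite big_geq//.
  rewrite integral_cst// -[RHS]mule1; congr (_ * _).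
  exact: probability_setT.
apply: (ge0_integral_gamma_law mS) => //.
exact: (gamma_law_partial_sum b0 Gg Gind).
Qed.

(** The partial sums have gamma laws of these shapes, and a gamma law exists only if its integral
    converges. *)
Lemma compound_poisson_gamma_fun (lam p b : R) (X : R -> {RV P >-> R}) :
  (0 < b)%R -> compound_poisson_gamma lam p b X -> forall n,
  \int[mu]_x (gamma_kernel (p * n.+1%:R) 1 x)%:E = (gamma_fun (p * n.+1%:R))%:E /\
  (0 < gamma_fun (p * n.+1%:R))%R.
Proof.
move=> b0 [N [G [_ Gg Gind _ _]]] n.
exact: (gamma_law_integral b0 (gamma_law_partial_sum b0 Gg Gind n)).
Qed.

End expectations.

(** * The subordinated difference *)

Section subordinated_difference.
Context d (T : measurableType d) (R : realType) (P : probability T R).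
Variables (lam lam1 lam2 a b : R).
Variables (N1 N2 : R -> {RV P >-> nat}) (GN : R -> {RV P >-> R}).
Hypotheses (lam_gt0 : 0 < lam) (lam1_gt0 : 0 < lam1) (lam2_gt0 : 0 < lam2).
Hypotheses (a_gt0 : 0 < a) (b_gt0 : 0 < b).
Hypotheses (N1P : poisson_process lam1 N1) (N2P : poisson_process lam2 N2).
Hypothesis GNP : compound_poisson_gamma lam a b GN.
Hypothesis ind : independent P
  (tnth [tuple sigma_process N1; sigma_process N2; sigma_process GN]).
Variable t : R.
Hypothesis t_ge0 : 0 <= t.
Local Open Scope ereal_scope.
Local Notation mu := (@lebesgue_measure R).

Let N1N2X s m k (A : set R) : measurable A ->
  P ([set w | N1 s w = m] `&` [set w | N2 s w = k] `&` GN t @^-1` A) =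
  P [set w | N1 s w = m] * P [set w | N2 s w = k] * P (GN t @^-1` A).
Proof.
move=> mA.
pose B (i : 'I_3) :=
  tnth [tuple [set w | N1 s w = m]; [set w | N2 s w = k]; GN t @^-1` A] i.
have := ind (s := [:: ord0; lift ord0 ord0; ord_max]) (A := B).
rewrite !big_cons !big_nil setIT mule1 setIA muleA; apply => //.
move=> i; rewrite !inE => /or3P[] /eqP ->; rewrite /B !(tnth_nth set0)/=;
  apply: sub_sigma_algebra.
- by exists s => //; exists [set m] => //; rewrite setTI.
- by exists s => //; exists [set k] => //; rewrite setTI.
- by exists t => //; exists A => //; rewrite setTI.
Qed.

Let E m k := [set w | N1 (GN t w) w = m /\ N2 (GN t w) w = k].

Let q m k (x : R) : R := (poisson_mass (lam1 * Num.max x 0) m *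
  poisson_mass (lam2 * Num.max x 0) k)%R.

Let mE m k : measurable (E m k).
Proof. exact: (measurable_poisson_random_time (GN t) N1P N2P). Qed.

Let PE m k : P (E m k) = \int[P]_w (q m k (GN t w))%:E.
Proof. exact: (poisson_random_time lam1_gt0 lam2_gt0 N1P N2P N1N2X). Qed.

Let max0 (x : R) : (0 <= Num.max x 0)%R.
Proof. by rewrite le_max lexx orbT. Qed.

Let q_ge0 m k x : 0 <= (q m k x)%:E.
Proof. by rewrite lee_fin mulr_ge0// poisson_mass_ge0// mulr_ge0 ?max0 ?ltW. Qed.

Let mq m k : measurable_fun [set: R] (fun x => (q m k x)%:E).
Proof.
apply/measurable_EFinP; have mm l j : measurable_fun [set: R]
    (fun x : R => poisson_mass (l * Num.max x 0) j)%R.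
  apply: (measurableT_comp (measurable_poisson_mass j)).
  by apply: measurable_funM => //; exact: measurable_maxr.
exact: measurable_funM.
Qed.

Let mqX m k : measurable_fun [set: T] (fun w => (q m k (GN t w))%:E).
Proof. exact: (measurableT_comp (mq m k)). Qed.

Let S := subordinated_difference N1 N2 GN.

(** The first term comes from the event without jumps, on which [GN t] and hence [S t] are 0. The
    integral carries the absolutely continuous part of the law of [GN t]. *)
Lemma subordinated_difference_mass (k : int) :
  P [set w | S t w = k] =
  ((k == 0)%:R * expR (- (lam * t)))%:E +
   (expR (- (lam * t)) * (lam1 / lam2) `^ (k%:~R / 2))%:E *
   \int[mu]_(u in `]0%R, +oo[)
     (expR (- (u * (lam1 + lam2 + b))) *
      besselI `|k|%N (2 * u * Num.sqrt (lam1 * lam2)) *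
      u^-1 * wright0 a (lam * t * (b * u) `^ a))%:E.
Proof.
(* [p] and [r] are the positive and negative parts of [k]. *)
have [p [r [kE pr]]] : exists p r : nat, k = (p%:Z - r%:Z)%R /\ (p * r = 0)%N.
  case: k => k; first by exists k, 0%N; rewrite subr0 muln0.
  by exists 0%N, k.+1; rewrite sub0r NegzE.
(* Conditional probability of the difference [k], given [GN t] = x. *)
pose h x := \sum_(0 <= n <oo) (q (n + p)%N (n + r)%N x)%:E.
have h0 x : 0 <= h x by apply: nneseries_ge0.
have mh : measurable_fun [set: R] h.
  by apply: ge0_emeasurable_sum => // n x _ _; exact: q_ge0.
have hE x : (0 <= x)%R -> h x = ((lam1 / lam2) `^ (k%:~R / 2) *
    (expR (- (x * (lam1 + lam2))) *
     besselI `|k|%N (2 * x * Num.sqrt (lam1 * lam2))))%:E.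
  move=> x0; rewrite -(poisson_masses_besselI lam1_gt0 lam2_gt0 x0 kE pr).
  by apply: eq_eseriesr => n _; rewrite /q max_l.
transitivity (\int[P]_w h (GN t w)).
  rewrite (_ : [set w | _] = \bigcup_n E (n + p)%N (n + r)%N); last first.
    apply/seteqP; split => w /=; rewrite /S /subordinated_difference kE.
      move=> Sw; exists (N1 (GN t w) w - p)%N => //=; rewrite /E/=.
      by move: pr => /eqP; rewrite muln_eq0 => /orP[] /eqP; lia.
    by move=> [n _] [-> ->]; rewrite !PoszD; lia.
  rewrite measure_bigcup//=; last first.
    apply/trivIsetP => i j _ _ /eqP ij; apply/seteqP; split => // w [] [e1 _] [e2 _].
    by apply: ij; apply/eqP; rewrite -(eqn_add2r p) -e1 -e2.
  rewrite /h integral_nneseries//.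
  rewrite (@eq_eseriesl _ _ xpredT); last by move=> n; rewrite in_setT.
  by apply: eq_eseriesr => n _; exact: PE.
rewrite (compound_poisson_gamma_integral lam_gt0 b_gt0 t_ge0 GNP mh h0).
(* The term of index 0, the atom of [GN t] at 0, is split off. *)
rewrite nneseries_recl//; last first.
  move=> [|n] _ /=; apply: mule_ge0 => //;
    rewrite ?lee_fin ?poisson_mass_ge0 ?mulr_ge0 ?(ltW lam_gt0)//.
  by apply: integral_ge0 => x _; rewrite mule_ge0// lee_fin gamma_pdf_ge0.
congr (_ + _).
  (* At time 0 both counts are 0, so the atom contributes only when [k] is 0. *)
  have q0 i j : q i j 0 = ((i == 0%N)%:R * (j == 0%N)%:R)%R.
    rewrite /q maxxx !mulr0 /poisson_mass !expr0n oppr0 expR0 !mulr1.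
    by case: i j => [|i] [|j]; rewrite /= ?fact0 ?invr1 ?(mulr1, mulr0, mul0r).
  rewrite /= /h /poisson_mass expr0 fact0 invr1 !mul1r.
  under eq_eseriesr do rewrite q0.
  have [k0|k0] := eqVneq k 0%R.
    have [-> ->] : p = 0%N /\ r = 0%N.
      by move: pr => /eqP; rewrite muln_eq0 => /orP[] /eqP; lia.
    rewrite nneseries_recl//= mulr1 mul1r eseries0 ?adde0 ?mule1//.
    by move=> [|n]//= _ _; rewrite mul0r.
  rewrite mul0r eseries0 ?mule0// => n _ _.
  case: n => [|n]; rewrite ?mul0r//= !add0n.
  have [p0|] := eqVneq p 0%N; last by rewrite mul0r.
  have [r0|] := eqVneq r 0%N; last by rewrite mulr0.
  by move: k0; rewrite kE p0 r0 subr0 eqxx.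
have GF := compound_poisson_gamma_fun b_gt0 GNP.
(* Contribution of exactly n + 1 jumps to the density of [GN t]. *)
pose g n x : R := (poisson_mass (lam * t) n.+1 * gamma_pdf (a * n.+1%:R) b x)%R.
have pm0 n : (0 <= poisson_mass (lam * t) n)%R.
  by rewrite poisson_mass_ge0// mulr_ge0// ltW.
have g0 n x : 0 <= (g n x)%:E by rewrite lee_fin mulr_ge0// gamma_pdf_ge0.
have mg n : measurable_fun [set: R] (fun x => (g n x)%:E).
  apply/measurable_EFinP; apply: measurable_funM => //.
  exact: measurable_gamma_pdf.
pose F x := h x * \sum_(0 <= n <oo) (g n x)%:E.
have sg0 x : 0 <= \sum_(0 <= n <oo) (g n x)%:E by apply: nneseries_ge0.
have F0 x : 0 <= F x by rewrite mule_ge0.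
have msg : measurable_fun [set: R] (fun x => \sum_(0 <= n <oo) (g n x)%:E).
  by apply: ge0_emeasurable_sum => // n x _ _; exact: g0.
have mF : measurable_fun [set: R] F by exact: emeasurable_funM.
(* The powers (lam t)^(n+1) and (b x)^(a(n+1)) gather into the argument of the Wright function,
   leaving one factor 1/x. *)
have gE x : (0 < x)%R -> \sum_(0 <= n <oo) (g n x)%:E =
    (expR (- (lam * t)) * (expR (- (b * x)) * x^-1) *
     wright0 a (lam * t * (b * x) `^ a))%:E.
  move=> x0; have z0 : (0 <= lam * t * (b * x) `^ a)%R.
    by rewrite !mulr_ge0 ?powR_ge0// ltW.
  rewrite EFinM -(wright0_series a_gt0 z0 (fun n => (GF n).1)) -nneseriesZl; last first.
    by move=> n _; rewrite lee_fin divr_ge0 ?exprn_ge0// mulr_ge0// ltW// (GF n).2.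
  apply: eq_eseriesr => n _; rewrite -EFinM; congr EFin.
  rewrite /g /poisson_mass gamma_pdfE /gamma_kernel x0.
  rewrite [in RHS]exprMn [in RHS]powRM ?(ltW b_gt0) ?(ltW x0)//.
  rewrite -[((b `^ a * x `^ a) ^+ n.+1)%R]powR_mulrn ?mulr_ge0 ?powR_ge0//.
  rewrite powRM ?powR_ge0// -!powRrM.
  rewrite powRD ?(gt_eqF x0) ?implybT// powR_inv1 ?(ltW x0)//.
  field.
  rewrite !gt_eqF ?ltr0n ?fact_gt0//; exact: (GF n).2.
transitivity (\int[mu]_(x in `]0%R, +oo[) F x).
  rewrite -(nneseries_addn 1); last first.
    move=> [|n] /=; apply: mule_ge0 => //; rewrite ?lee_fin//.
    by apply: integral_ge0 => x _; rewrite mule_ge0// lee_fin gamma_pdf_ge0.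
  have mhg n : measurable_fun [set: R] (fun x => h x * (g n x)%:E).
    by apply: emeasurable_funM => //; exact: mg.
  transitivity (\sum_(0 <= n <oo) \int[mu]_x (h x * (g n x)%:E)).
    apply: eq_eseriesr => n _; rewrite addn1 /=.
    rewrite -ge0_integralZl_EFin//.
    - by apply: eq_integral => x _; rewrite /g EFinM muleCA.
    - by move=> x _; rewrite mule_ge0// lee_fin gamma_pdf_ge0.
    - apply: (emeasurable_funM mh); apply/measurable_EFinP.
      exact: measurable_gamma_pdf.
  rewrite -integral_nneseries//; last by move=> n x _; rewrite mule_ge0.
  rewrite [RHS]integral_mkcond; apply: eq_integral => x _.
  rewrite patchE mem_setE in_itv/= andbT; case: ifPn => [x0|x0].
    by rewrite /F hE ?(ltW x0)// nneseriesZl.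
  rewrite eseries0// => n _ _.
  by rewrite /g gamma_pdfE /gamma_kernel (negbTE x0) !mulr0 mule0.
pose C := (expR (- (lam * t)) * (lam1 / lam2) `^ (k%:~R / 2))%R.
have C0 : (0 < C)%R by rewrite mulr_gt0 ?expR_gt0 ?powR_gt0 ?divr_gt0.
have -> : \int[mu]_(u in `]0%R, +oo[)
     (expR (- (u * (lam1 + lam2 + b))) *
      besselI `|k|%N (2 * u * Num.sqrt (lam1 * lam2)) *
      u^-1 * wright0 a (lam * t * (b * u) `^ a))%:E =
    \int[mu]_(u in `]0%R, +oo[) (C^-1%:E * F u).
  apply: eq_integral => u /set_mem/=; rewrite in_itv/= andbT => u0.
  rewrite /F hE ?(ltW u0)// gE// -!EFinM; congr EFin.
  have -> : expR (- (u * (lam1 + lam2 + b))) =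
    (expR (- (u * (lam1 + lam2))) * expR (- (b * u)))%R.
    by rewrite -expRD; congr expR; ring.
  rewrite /C; field.
  by rewrite !gt_eqF ?expR_gt0 ?powR_gt0 ?divr_gt0.
have mF' : measurable_fun (`]0%R, +oo[%classic : set R) F by exact: measurable_funTS.
have mI : measurable (`]0%R, +oo[%classic : set R) by [].
have C0' : (0 <= C^-1)%R by rewrite invr_ge0 ltW.
rewrite (ge0_integralZl_EFin mu mI (fun x _ => F0 x) mF' C0').
by rewrite muleA -EFinM divff ?mul1e// gt_eqF.
Qed.

(** Given [GN t] = x, the conditional expectation is e^(-s x) with s = c - b. Under the gamma law of
    n jumps it integrates to (b/c)^(a n), and the Poisson generating function sums over n. *)
Lemma subordinated_difference_mgf (theta : R) :
  let c := (b + lam1 + lam2 - lam1 * expR theta - lam2 * expR (- theta))%R in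
  (0 < c)%R ->
  'M_P (fun w => (S t w)%:~R : R) theta =
  (expR (- (lam * t * (1 - b `^ a * c `^ (- a)))))%:E.
Proof.
move=> c c0.
set x1 := expR theta in c c0 *; set x2 := expR (- theta) in c c0 *.
have x10 : (0 <= x1)%R by exact: expR_ge0.
have x20 : (0 <= x2)%R by exact: expR_ge0.
pose n1 w := N1 (GN t w) w; pose n2 w := N2 (GN t w) w.
pose v m k : R := (x1 ^+ m * x2 ^+ k)%R.
have v0 m k : (0 <= v m k)%R by rewrite mulr_ge0 ?exprn_ge0.
pose f w : \bar R := (v (n1 w) (n2 w))%:E.
pose A1 m := [set w | n1 w = m]; pose A2 k := [set w | n2 w = k].
have A1E m : A1 m = \bigcup_k E m k.
  apply/seteqP; split => [w <-|w [k _] [<-]//]; by exists (n2 w).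
have A2E k : A2 k = \bigcup_m E m k.
  apply/seteqP; split => [w <-|w [m _] [_ <-]//]; by exists (n1 w).
have mA1 m : measurable (A1 m) by rewrite A1E; exact: bigcupT_measurable.
have mA2 m : measurable (A2 m) by rewrite A2E; exact: bigcupT_measurable.
have A1T : \bigcup_m A1 m = setT by exact: bigcup_fibers.
have A2T : \bigcup_k A2 k = setT by exact: bigcup_fibers.
(* [f] is constant on each of the countably many events [E m k]. *)
have mf : measurable_fun setT f.
  rewrite -A1T; apply/measurable_fun_bigcup => // m; rewrite A1E.
  apply/measurable_fun_bigcup => // k.
  apply: (@eq_measurable_fun _ _ _ _ _ (cst (v m k)%:E)); last exact: measurable_cst.
  by move=> w /set_mem [] <- <-.
have f0 w : 0 <= f w by rewrite lee_fin.
pose s := (lam1 + lam2 - lam1 * x1 - lam2 * x2)%R.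
pose h (x : R) : \bar R := (expR (- (s * Num.max x 0)))%:E.
have h0 x : 0 <= h x by rewrite lee_fin expR_ge0.
have mh : measurable_fun [set: R] h.
  apply/measurable_EFinP; apply: measurableT_comp => //.
  apply: measurableT_comp => //; apply: measurable_funM => //.
  exact: measurable_maxr.
transitivity (\int[P]_w f w).
  rewrite /mmt_gen_fun unlock; apply: eq_integral => w _ /=.
  congr EFin; rewrite /v /x1 /x2 -!expRM_natl -expRD; congr expR.
  rewrite /S /subordinated_difference rmorphB/= !pmulrn -/(n1 w) -/(n2 w); ring.
have qv0 m k w : 0 <= (v m k)%:E * (q m k (GN t w))%:E by rewrite mule_ge0// lee_fin.
have mqv m k : measurable_fun setT (fun w => (v m k)%:E * (q m k (GN t w))%:E).
  by apply: emeasurable_funM => //; exact: measurable_cst.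
transitivity (\int[P]_w h (GN t w)).
  rewrite (ge0_integral_partition P measurableT mA1 _ A1T mf f0);
    last exact: trivIset_fibers.
  transitivity (\sum_(0 <= m <oo) \int[P]_w \sum_(0 <= k <oo)
      ((v m k)%:E * (q m k (GN t w))%:E)).
    apply: eq_eseriesr => m _; rewrite setTI.
    rewrite (ge0_integral_partition P (mA1 m) mA2 _ A2T mf f0);
      last exact: trivIset_fibers.
    rewrite integral_nneseries//; apply: eq_eseriesr => k _.
    rewrite ge0_integralZl_EFin// -PE -integral_cst//.
    by apply: eq_integral => w /set_mem [] /= <- <-.
  rewrite -integral_nneseries//; last 2 first.
  - by move=> m; apply: ge0_emeasurable_sum.
  - by move=> m w _; exact: nneseries_ge0.
  apply: eq_integral => w _; set x := Num.max (GN t w) 0%R.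
  have x0 : (0 <= x)%R by exact: max0.
  have lx1 : (0 <= lam1 * x)%R by rewrite mulr_ge0// ltW.
  have lx2 : (0 <= lam2 * x)%R by rewrite mulr_ge0// ltW.
  (* The double sum factors into two Poisson generating functions, at [x2] and at [x1]; their
     exponents add up to -s x. *)
  transitivity (\sum_(0 <= m <oo) ((expR (lam2 * x * (x2 - 1)))%:E *
      (x1 ^+ m * poisson_mass (lam1 * x) m)%:E)).
    apply: eq_eseriesr => m _.
    rewrite muleC -poisson_mass_generating// -nneseriesZl; last first.
      by move=> k _; rewrite lee_fin mulr_ge0 ?exprn_ge0 ?poisson_mass_ge0.
    by apply: eq_eseriesr => k _; rewrite -!EFinM /v /q -/x; congr EFin; ring.
  rewrite nneseriesZl; last first.
    by move=> k _; rewrite lee_fin mulr_ge0 ?exprn_ge0 ?poisson_mass_ge0.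
  rewrite poisson_mass_generating// -EFinM -expRD /h -/x; congr (expR _)%:E.
  rewrite /s; ring.
rewrite (compound_poisson_gamma_integral lam_gt0 b_gt0 t_ge0 GNP mh h0).
have GF := compound_poisson_gamma_fun b_gt0 GNP.
(* The target is the Poisson generating function at b^a c^(-a); expanding it allows a comparison
   term by term. *)
have -> : (- (lam * t * (1 - b `^ a * c `^ (- a))) =
  lam * t * (b `^ a * c `^ (- a) - 1))%R by ring.
rewrite -poisson_mass_generating ?mulr_ge0 ?powR_ge0 ?(ltW lam_gt0)//.
apply: eq_eseriesr => n _; rewrite [RHS]EFinM [RHS]muleC; congr (_ * _).
case: n => [|n] /=; first by rewrite /h maxxx mulr0 oppr0 expR0 expr0.
set p := (a * n.+1%:R)%R; have [pE p0] := GF n.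
(* Multiplying by e^(-s x) changes the rate of the kernel from [b] to [c]. *)
transitivity (\int[mu]_x ((b `^ p / gamma_fun p)%:E * (gamma_kernel p c x)%:E)).
  apply: eq_integral => x _; rewrite -!EFinM; congr EFin.
  rewrite gamma_pdfE mulrCA; congr (_ * _)%R.
  rewrite /gamma_kernel; case: ifPn => x0; last by rewrite mulr0.
  rewrite max_l ?(ltW x0)// mulrCA -expRD; congr (_ * expR _)%R.
  rewrite /s /c; ring.
rewrite ge0_integralZl_EFin//; last 3 first.
- by move=> x _; rewrite lee_fin gamma_kernel_ge0.
- by apply/measurable_EFinP; exact: measurable_gamma_kernel.
- by rewrite divr_ge0 ?powR_ge0 ?ltW.
rewrite integral_gamma_kernel// pE -!EFinM; congr EFin.
rewrite exprMn -!powR_mulrn ?powR_ge0// -!powRrM mulNr -/p.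
by field; rewrite gt_eqF.
Qed.

End subordinated_difference.

(** The Wright series starts at index 1, so the paths without jumps, of probability e^(-lam t),
    enter through the separate term at [k = 0]. The condition [0 < c] places the generating function
    where gamma integrals of rate [c] converge. *)
Theorem theorem3 (d : measure_display) (T : measurableType d) (R : realType)
    (P : probability T R) (lam lam1 lam2 a b : R)
    (N1 N2 : R -> {RV P >-> nat}) (GN : R -> {RV P >-> R}) :
  0 < lam -> 0 < lam1 -> 0 < lam2 -> 0 < a -> 0 < b ->
  poisson_process lam1 N1 -> poisson_process lam2 N2 ->
  compound_poisson_gamma lam a b GN ->
  independent P
    (tnth [tuple sigma_process N1; sigma_process N2; sigma_process GN]) ->
  let S := subordinated_difference N1 N2 GN in
  forall t : R, 0 <= t ->
    (forall k : int,
      P [set w | S t w = k] =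
      (((k == 0)%:R * expR (- (lam * t)))%:E +
       (expR (- (lam * t)) * (lam1 / lam2) `^ (k%:~R / 2))%:E *
       \int[lebesgue_measure]_(u in `]0%R, +oo[)
         (expR (- (u * (lam1 + lam2 + b))) *
          besselI `|k|%N (2 * u * Num.sqrt (lam1 * lam2)) *
          u^-1 * wright0 a (lam * t * (b * u) `^ a))%:E)%E) /\
    (forall theta : R,
      let c := b + lam1 + lam2 - lam1 * expR theta - lam2 * expR (- theta) in
      0 < c ->
      'M_P (fun w => (S t w)%:~R : R) theta =
      (expR (- (lam * t * (1 - b `^ a * c `^ (- a)))))%:E).
Proof.
move=> lam_gt0 lam1_gt0 lam2_gt0 a_gt0 b_gt0 N1P N2P GNP ind S t t_ge0; split.
- by move=> k; exact: subordinated_difference_mass.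
- by move=> theta c c_gt0; exact: subordinated_difference_mgf.
Qed.
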